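(* $2^{\mathbb{N}}$, $\mathbb{Z}^{\mathbb{N}}$ and $\mathbb{Q}^{\mathbb{N}}$, ordered lexicographically, are not strongly surjective.
   Context: A (non-empty) linear order $M$ is strongly surjective if for every non-empty linear order $L$ that embeds into $M$ (via an order preserving injection) there is an epimorphism (order preserving surjection) from $M$ onto $L$. For a linear order $L$, $L^{\mathbb{N}}$ is the set of all sequences $\mathbb{N}\to L$; in the lexicographic order two distinct sequences are compared at the least index where they differ. Here $2=\{0,1\}$ with $0<1$. *)

(* Defs.v *)
From mathcomp Require Import all_boot all_order all_algebra.
From mathcomp Require Import classical_orders.

Set Implicit Arguments.
Unset Strict Implicit.
Unset Printing Implicit Defensive.

(* An element of {omorphism A -> B} is a non-strictly monotone map, so an
   injective one is strictly increasing, while an epimorphism may identify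
   points. *)
Definition embeds d d' (L : orderType d) (M : orderType d') : Prop :=
  exists f : {omorphism L -> M}, injective f.

Definition epimorphic d d' (M : orderType d) (L : orderType d') : Prop :=
  exists f : {omorphism M -> L}, forall y : L, exists x : M, f x = y.

(* Nonemptiness of M is left to the user of the predicate. *)
Definition strongly_surjective d (M : orderType d) : Prop :=
  forall (d' : Order.disp_t) (L : orderType d'),
    inhabited L -> embeds L M -> epimorphic M L.

(* big_lexi_order compares two distinct sequences at the least index where
   they differ. *)
Definition lexpow d (L : orderType d) : orderType d :=
  big_lexi_order (fun _ : nat => L).

(* Main.v *)
(* A Cantor diagonal argument. When A is countable with at least two points,
   M = A^N carries a countable family of initial segments U_i separating its
   points. An initial segment P of M is determined by the set of those i with P
   contained in U_i, together with whether P has a maximum; and a monotone map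
   f : M -> M is determined by the initial segments f^-1(U_i). Hence monotone
   self-maps are coded injectively by binary sequences, so by points of M, and
   the suborder {code f | code f not in f(M)} is not a monotone image of M. *)
Require Import Defs.
From HB Require Import structures.
From mathcomp Require Import all_boot all_order all_algebra.
From mathcomp Require Import boolp classical_sets classical_orders.

Set Implicit Arguments.
Unset Strict Implicit.
Unset Printing Implicit Defensive.

Import Order.TTheory.
Local Open Scope classical_set_scope.
Local Open Scope order_scope.

Lemma coded_self_maps_not_strongly_surjective d (M : orderType d)
    (code : (M -> M) -> M) :
  (forall f g : M -> M, {homo f : x y / x <= y} -> {homo g : x y / x <= y} ->
     code f = code g -> f = g) ->
  (exists x y : M, x != y) -> ~ strongly_surjective M.
Proof.
move=> codeI [x0 [x1 x01]] ssM.
pose D : pred M := fun x => `[< exists f : M -> M,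
  [/\ {homo f : x y / x <= y}, x = code f & ~ range f x] >].
pose L : orderType d := HB.pack (sig D)
  ([SubChoice_isSubOrder of (sig D) by <: with d]).
(* Otherwise [y] is the code of the constant map [y] for every [y], which
   leaves no code for [id]. *)
have [z Dz] : exists z, D z.
  apply: contrapT => D0.
  have mem f : {homo f : x y / x <= y} -> range f (code f).
    move=> fh; apply: contrapT => nf; apply: D0.
    by exists (code f); apply/asboolP; exists f.
  have ch (y : M) : {homo (fun _ : M => y) : a b / a <= b} by [].
  have [x _ cx] := mem _ (ch (code id)).
  have E := codeI id _ (fun a b => id) (ch _) cx.
  move/eqP: x01; apply.
  exact: etrans (congr1 (@^~ x0) E) (esym (congr1 (@^~ x1) E)).
have emb : embeds L M.
  pose v : L -> M := fun x => sval x.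
  have vh : {homo v : x y / x <= y} by [].
  pose v' : {omorphism L -> M} :=
    HB.pack v (Order.isOrderMorphism.Build _ _ _ _ v vh).
  by exists v'; exact: val_inj.
have [f fsurj] := ssM _ L (inhabits (exist _ z Dz : L)) emb.
pose g : M -> M := fun x => sval (f x).
have gh : {homo g : x y / x <= y} by move=> x y /(omorph_le f).
have rangeg x : range g x <-> D x.
  split=> [[y _ <-]|Dx]; first exact: valP (f y).
  have [y fy] := fsurj (exist _ x Dx : L).
  by exists y => //; rewrite /g fy.
(* Were [code g] in [D], injectivity of [code] would make its witness equal to [g], so [code g]
   would miss the range of [g], which is [D]. Missing that range in turn puts [code g] into [D]. *)
have nDg : ~ D (code g).
  move=> /[dup] /rangeg rg /asboolP[h [hh /(codeI _ _ gh hh) ghE]].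
  by rewrite -ghE.
by apply: (nDg); apply/asboolP; exists g; split=> // /rangeg.
Qed.

Definition has_max d (M : orderType d) (P : set M) : Prop :=
  exists2 m, P m & forall x, P x -> x <= m.

Definition separating d (M : orderType d) I (U : I -> set M) : Prop :=
  forall x y, x < y -> exists2 i, U i x & ~ U i y.

Definition initial_segment d (M : orderType d) (P : set M) : Prop :=
  forall x y, x <= y -> P y -> P x.

(* If x is in P but not in Q, then the first hypothesis forces P to be the set
   of points at most x and Q the set of points below x without maximum. *)
Lemma initial_segment_sub d (M : orderType d) I (U : I -> set M) (P Q : set M) :
  separating U -> (forall i, initial_segment (U i)) ->
  initial_segment P -> initial_segment Q ->
  (forall i, Q `<=` U i -> P `<=` U i) -> (has_max P -> has_max Q) ->
  P `<=` Q.
Proof.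
move=> sepU iU iP iQ PQ mPQ x Px; apply: contrapT => nQx.
have Qx y : Q y -> y < x.
  by rewrite ltNge => Qy; apply/negP => /iQ /(_ Qy).
have ltU y i : ~ U i y -> P y -> exists2 z, Q z & ~ U i z.
  move=> nUy Py; apply: contrapT => nE; apply: nUy; apply: (PQ i) => // z Qz.
  by apply: contrapT => nUz; apply: nE; exists z.
have out i y z : U i y -> ~ U i z -> y < z.
  by move=> Uy nUz; rewrite ltNge; apply/negP => /iU /(_ Uy).
(* Each appeal to [ltU] yields a point of [Q] that is too large: above [x] if [x] is not the maximum
   of [P], then above the maximum [m] of [Q]. *)
have [|m Qm mub] := mPQ.
  exists x => // y Py; rewrite leNgt; apply/negP => /sepU[i Ux nUy].
  have [z /Qx zx /(out _ _ _ Ux)] := ltU _ _ nUy Py.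
  by rewrite ltNge (ltW zx).
have [i Um nUx] := sepU _ _ (Qx _ Qm).
have [z /mub zm /(out _ _ _ Um)] := ltU _ _ nUx Px.
by rewrite ltNge zm.
Qed.

Section CodeByBits.
Context d (M : orderType d) (I : countType) (U : I -> set M).
Hypothesis sepU : separating U.
Hypothesis iU : forall i, initial_segment (U i).

Definition bits (f : M -> M) (n : nat) : bool :=
  match unpickle n : option (I * option I) with
  | Some (i, Some j) => `[< f @^-1` U i `<=` U j >]
  | Some (i, None) => `[< has_max (f @^-1` U i) >]
  | None => false
  end.

(** If [g x < f x], some [U i] contains [g x] but not [f x], so [x] lies in its preimage under [g]
    only; equal bits forbid this by [initial_segment_sub]. *)
Lemma bits_le (f g : M -> M) :
  {homo f : x y / x <= y} -> {homo g : x y / x <= y} ->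
  bits f = bits g -> forall x, f x <= g x.
Proof.
move=> fh gh E x; rewrite leNgt; apply/negP => /sepU[i Ug nUf]; apply: nUf.
have pre (h : M -> M) :
    {homo h : x y / x <= y} -> initial_segment (h @^-1` U i).
  by move=> hh a b /hh ab; exact: iU ab.
have Ei (k : option I) : bits f (pickle (i, k)) = bits g (pickle (i, k)).
  by rewrite E.
suff: g @^-1` U i `<=` f @^-1` U i by exact.
apply: (initial_segment_sub sepU iU (pre _ gh) (pre _ fh)) => [j|].
  have := Ei (Some j); rewrite /bits pickleK => Ej Pj.
  by apply/asboolP; rewrite -Ej; exact/asboolP.
have := Ei None; rewrite /bits pickleK => Em Pm.
by apply/asboolP; rewrite Em; exact/asboolP.
Qed.

Lemma bits_inj (f g : M -> M) :
  {homo f : x y / x <= y} -> {homo g : x y / x <= y} ->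
  bits f = bits g -> f = g.
Proof.
by move=> fh gh E; apply/funext => x; apply/le_anti; rewrite !bits_le.
Qed.

End CodeByBits.

Section LexPower.
Context d (A : orderType d).

Lemma lexpow_ltP (x y : lexpow A) :
  x < y <-> exists2 n, (forall i, (i < n)%N -> x i = y i) & x n < y n.
Proof.
rewrite lt_neqAle leEbig_lexi_order; split.
  case/andP; case E : (first_diff x y) => [n|]; last first.
    by move/first_diff_NoneP : E => ->; rewrite eqxx.
  case/first_diff_SomeP : E => xy xyn _ le; exists n => //.
  by rewrite lt_neqAle xyn.
move=> [n xy]; rewrite lt_neqAle => /andP[xyn le].
have E : first_diff x y = Some n by apply/first_diff_SomeP.
by rewrite E le andbT; apply/eqP => xyE; rewrite xyE eqxx in xyn.
Qed.

(** These are the points below every sequence that begins with [s]. Only indices under [size s]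
    occur, so the defaults of [nth] are never returned. *)
Definition below_word (s : seq A) : set (lexpow A) := fun z =>
  exists n, [/\ (n < size s)%N, (forall i, (i < n)%N -> z i = nth (z i) s i)
    & z n < nth (z n) s n].

Lemma below_word_initial s : initial_segment (below_word s).
Proof.
move=> x y; rewrite le_eqVlt => /predU1P[->//|/lexpow_ltP[k xy xyk]].
move=> [n [ns ys yn]].
have nthE a b i : (i < size s)%N -> nth a s i = nth b s i.
  exact: set_nth_default.
(* [x] first departs from [s] at the smaller of [k] and [n], and drops below it there. *)
case: (ltngtP k n) => [kn|nk|kn].
- exists k; split; first exact: ltn_trans ns.
    by move=> i ik; rewrite xy // {1}ys ?(ltn_trans ik).
  by rewrite (nthE _ (y k)) ?(ltn_trans kn) // -ys.
- exists n; split=> [//|i iN|]; last by rewrite xy.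
  by rewrite xy ?(ltn_trans iN) //; exact: ys.
- subst k; exists n; split=> [//|i iN|]; first by rewrite xy //; exact: ys.
  by rewrite (nthE _ (y n)) //; exact: lt_trans yn.
Qed.

Lemma below_word_separating : separating below_word.
Proof.
(* The prefix of [y] through index [n]: [x] falls below it at [n], while [y] never leaves it. *)
move=> x y /lexpow_ltP[n xy xyn]; exists (mkseq y n.+1).
  exists n; rewrite size_mkseq; split=> // [i iN|]; rewrite nth_mkseq //.
    exact: xy.
  exact: ltnW.
move=> [k []]; rewrite size_mkseq => kn _.
by rewrite nth_mkseq // ltxx.
Qed.

Lemma countable_lexpow_not_strongly_surjective (h : A -> nat) h' (a0 a1 : A) :
  pcancel h h' -> a0 != a1 -> ~ strongly_surjective (lexpow A).
Proof.
move=> hK a01.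
(* [pcan_type hK] is [A] made countable through [h], so its words form a countable index type. *)
pose I : countType := seq (pcan_type hK).
pose U : I -> set (lexpow A) := below_word.
pose code (f : lexpow A -> lexpow A) : lexpow A :=
  fun n => if bits U f n then a1 else a0.
apply: (@coded_self_maps_not_strongly_surjective _ _ code).
  move=> f g fh gh E; apply: (@bits_inj _ _ I U below_word_separating
    below_word_initial) fh gh _; apply/funext => n.
  have := congr1 (@^~ n) E; rewrite /code.
  do 2!case: ifP => //; move=> _ _ /eqP; first by rewrite eq_sym (negPf a01).
  by rewrite (negPf a01).
exists (fun=> a0), (fun=> a1); apply/eqP => /(congr1 (@^~ 0%N)) /eqP.
exact/negP.
Qed.

End LexPower.

Theorem corollary5p12 :
  [/\ ~ strongly_surjective (lexpow 'I_2),
      ~ strongly_surjective (lexpow int) &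
      ~ strongly_surjective (lexpow rat)].
Proof.
split.
- exact: (@countable_lexpow_not_strongly_surjective _ 'I_2 _ _ ord0 ord_max
    pickleK).
- exact: (@countable_lexpow_not_strongly_surjective _ int _ _ 0%R 1%R pickleK).
- exact: (@countable_lexpow_not_strongly_surjective _ rat _ _ 0%R 1%R pickleK).
Qed.
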